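(* Let $n,s,k,t$ be positive integers with $n\ge 2k^2$ and $k\ge 5st$ (for $t=1$ it suffices that $k\ge 3s$). Let $\mathcal A_0(n,k,s)=\{A\in\binom{[n]}{k}: A\cap[s]\ne\emptyset\}$. Then every family $\mathcal F\subset\binom{[n]}{k}$ with $\nu(\mathcal F)\le s$ satisfies $\delta_t(\mathcal F)\le \delta_t(\mathcal A_0(n,k,s))=\binom{n-t}{k-t}-\binom{n-s-t}{k-t}$, with equality only if $\mathcal F=\mathcal A_0(n,k,s)$.
   Context: $[n]=\{1,\dots,n\}$, $[s]=\{1,\dots,s\}$, and $\binom{[n]}{k}$ is the set of $k$-element subsets of $[n]$. The matching number $\nu(\mathcal F)$ is the maximum number of pairwise disjoint sets in $\mathcal F$. For $S\subset[n]$, its degree is the number of sets of $\mathcal F$ containing $S$; $\delta_t(\mathcal F)$ is the minimum degree of a $t$-element subset of $[n]$.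
   Formalization: Equality is shown to force F = A_0(n,k,s) only up to a permutation of [n]; literal equality fails, since for any other s-subset S of [n] the family of all k-sets meeting S has the same minimum t-degree and matching number at most s. *)

(* Defs.v *)
From mathcomp Require Import all_boot all_fingroup.

Set Implicit Arguments.
Unset Strict Implicit.
Unset Printing Implicit Defensive.

Definition ksets (T : finType) (k : nat) : {set {set T}} :=
  [set A : {set T} | #|A| == k].

Definition matching_number (T : finType) (F : {set {set T}}) : nat :=
  \max_(M : {set {set T}} | (M \subset F) && trivIset M) #|M|.

Definition degree (T : finType) (F : {set {set T}}) (S : {set T}) : nat :=
  #|[set A in F | S \subset A]|.

(* Every degree is at most #|F|, so the initial value #|F| does not affect the
   minimum as soon as T has a subset of size t. *)
Definition min_degree (T : finType) (t : nat) (F : {set {set T}}) : nat :=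
  \big[minn/#|F|]_(S in ksets T t) degree F S.

(* The set [s] inside the 0-based ground set 'I_n. *)
Definition initial (n s : nat) : {set 'I_n} := [set i : 'I_n | (i < s)%N].

Definition A0 (n k s : nat) : {set {set 'I_n}} :=
  [set A in ksets 'I_n k | A :&: initial n s != set0].

(* Equality of families up to relabelling the ground set: every family
   {A : A meets S}, for an s-subset S of 'I_n, has the same minimum degrees as
   A0, so that uniqueness of A0 can only hold in this sense. *)
Definition isomorphic_families (T : finType) (F G : {set {set T}}) : Prop :=
  exists sigma : {perm T}, G = [set [set sigma x | x in A] | A : {set T} in F].

(* Main.v *)
(* Averaging degrees over all t-sets shows that a family [F] violating the bound
   has more than |A0| - (s t / k + o(1)) C(n - s, k - 1) members, so it suffices
   to bound strictly below this the families with matching number at most [s]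
   that have no cover of size [s].
   Such a family is shifted (i <- j for i < j) as long as no cover of size [s]
   appears.  If one would appear, the current family has a minimal cover [W] of
   size [s + 1], and shifting inside [W] and inside its complement keeps [W]
   minimal; otherwise the family becomes fully shifted and [W] is the set of
   the [s + 1] smallest points.  In both cases the links G_0, ..., G_s of the
   traces {w}, w in W, on the complement of [W] are nested, and G_s <> set0.
   With N = C(n - s - 1, k - 1):
   - averaging over random disjoint (k - 1)-sets C_1, ..., C_m, which cannot be
     matched to all the links, |G_0| + ... + |G_{s-1}| + (m - s) |G_s| <= s N;
   - averaging in the complement of a member of G_s,
     |G_0| + ... + |G_{s-1}| + C(n - s - k, k - 1) <= s N;
   - the family H of the members missing [W] satisfies |H| <= s |shadow H|
     (Frankl) and its shadow lies in G_s, hence |H| <= s |G_s|.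
   Since n >= 2 k ^ 2, C(n - s - k, k - 1) is at least half of
   C(n - s, k - 1), which beats the deficit s t / k. *)

Require Import Defs.
From mathcomp Require Import all_boot all_fingroup.
From mathcomp.zify Require Import zify_ssreflect.

Set Implicit Arguments.
Unset Strict Implicit.
Unset Printing Implicit Defensive.

(** * Shifting *)

Section Shifting.
Variable T : finType.
Implicit Types (F : {set {set T}}) (A B S W : {set T}) (i j x y : T).

(** A matching is an indexed family, so that a shift can be undone member by member. Only
    disjointness prevents repetition, hence the empty set may be used several times. *)
Definition has_matching m F :=
  exists f : 'I_m -> {set T},
    (forall a, f a \in F) /\ (forall a b, a != b -> [disjoint f a & f b]).

Definition covers S F := [forall A in F, A :&: S != set0].

Definition swap i j A := i |: (A :\ j).

Definition shift_set F i j A :=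
  if [&& j \in A, i \notin A & swap i j A \notin F] then swap i j A else A.

Definition shift F i j := [set shift_set F i j A | A in F].

(** Potential function for termination: by [weight_shift], a shift towards smaller [r] that changes
    the family lowers it. *)
Definition weight (r : T -> nat) F := \sum_(A in F) \sum_(x in A) r x.

Lemma swapK i j A : j \in A -> i \notin A -> swap j i (swap i j A) = A.
Proof.
move=> jA iA; apply/setP=> x; rewrite !inE.
case: (x =P j) => [->|_] //=; case: (x =P i) => [->|_] //=.
by rewrite (negbTE iA).
Qed.

Lemma card_swap i j A : j \in A -> i \notin A -> #|swap i j A| = #|A|.
Proof.
move=> jA iA; rewrite cardsU1 !inE (negbTE iA) andbF (cardsD1 j A) jA.
by [].
Qed.

(** A member of the shifted family is either old, and then its own move was inapplicable or blocked
    by a set already in [F], or new, and then undoing the move leads back to [F]. *)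
Lemma shiftP F i j B : B \in shift F i j ->
  (B \in F /\ (j \in B -> i \notin B -> swap i j B \in F)) \/
  [/\ B \notin F, i \in B, j \notin B & swap j i B \in F].
Proof.
case/imsetP=> A AF ->; rewrite /shift_set.
case: ifPn => [/and3P[jA iA nF]|].
  right; split=> //; last by rewrite swapK.
    by rewrite !inE eqxx.
  rewrite !inE eqxx /= orbF; apply: contraNneq iA => <-; exact: jA.
move=> h; left; split=> // jA iA; move: h.
by rewrite jA iA /= negbK.
Qed.

Lemma mem_shift_id F i j A : A \in F -> (j \notin A) || (i \in A) ->
  A \in shift F i j.
Proof.
move=> AF h; apply/imsetP; exists A => //; rewrite /shift_set ifF //.
by case: (j \in A) h => //= ->.
Qed.

Lemma mem_shift_or F i j A : A \in F -> 
  A \in shift F i j \/ [/\ j \in A, i \notin A & swap i j A \in shift F i j].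
Proof.
move=> AF.
have: shift_set F i j A \in shift F i j by apply: imset_f.
rewrite /shift_set; case: ifP => [/and3P[? ? _]|]; by [right | left].
Qed.

Lemma mem_shift_both F i j A : A \in F -> swap i j A \in F ->
  A \in shift F i j.
Proof.
move=> AF AF'; apply/imsetP; exists A => //; rewrite /shift_set ifF //.
by rewrite AF' !andbF.
Qed.

(** A moved set lands outside [F] and an unmoved one stays inside, so the two kinds cannot collide;
    two moved sets are recovered by [swapK]. *)
Lemma shift_set_inj F i j : {in F &, injective (shift_set F i j)}.
Proof.
move=> A B AF BF; rewrite /shift_set.
case: ifPn => [/and3P[jA iA nA]|_]; case: ifPn => [/and3P[jB iB nB]|_] // E.
- by rewrite -(swapK jA iA) E swapK.
- by rewrite E BF in nA.
- by rewrite -E AF in nB.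
Qed.

Lemma card_shift F i j : #|shift F i j| = #|F|.
Proof. exact: (card_in_imset (@shift_set_inj F i j)). Qed.

Lemma shift_uniform k F i j :
  F \subset ksets T k -> shift F i j \subset ksets T k.
Proof.
move=> /subsetP FK; apply/subsetP=> _ /imsetP[A AF ->].
have := FK _ AF; rewrite !inE /shift_set.
by case: ifP => // /and3P[jA iA _]; rewrite card_swap.
Qed.

Lemma shift_fixed F i j A : shift F i j = F ->
  A \in F -> j \in A -> i \notin A -> swap i j A \in F.
Proof.
move=> E AF jA iA; case: (mem_shift_or i j AF); last by rewrite E; case.
case/shiftP => [[_]|[]]; [exact | by rewrite AF].
Qed.

Lemma weight_shift (r : T -> nat) F i j :
  r i < r j -> shift F i j != F -> weight r (shift F i j) < weight r F.
Proof.
move=> rij neq.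
have mv A : [&& j \in A, i \notin A & swap i j A \notin F] ->
    \sum_(x in shift_set F i j A) r x < \sum_(x in A) r x.
  move=> h; rewrite /shift_set h; case/and3P: h => jA iA _.
  rewrite big_setU1 /=; last by rewrite !inE (negbTE iA) andbF.
  by rewrite [ltnRHS](big_setD1 j) //= ltn_add2r.
have le A : \sum_(x in shift_set F i j A) r x <= \sum_(x in A) r x.
  case h: [&& j \in A, i \notin A & swap i j A \notin F].
    exact: ltnW (mv _ h).
  by rewrite /shift_set h.
have /exists_inP[A AF hA] :
    [exists A in F, [&& j \in A, i \notin A & swap i j A \notin F]].
  apply: contraNT neq; rewrite negb_exists_in => /forall_inP h.
  apply/eqP; rewrite -[RHS]imset_id; apply: eq_in_imset => A AF.
  by rewrite /shift_set (negbTE (h A AF)).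
rewrite /weight big_imset /=; last exact: shift_set_inj.
rewrite (big_setD1 A) //= [ltnRHS](big_setD1 A) //=.
by rewrite -addSn leq_add ?mv // leq_sum.
Qed.

(** New members all contain [i], so a matching of the shifted family uses at most one of them, and a
    single repair brings the matching back into [F]. *)
Lemma shift_has_matching m F i j :
  i != j -> has_matching m (shift F i j) -> has_matching m F.
Proof.
move=> nij [f [fF fD]].
have disjP A B x : [disjoint A & B] -> x \in A -> x \in B -> False.
  by move=> /pred0P /(_ x) /= /andP h xA xB; apply: h.
case: (pickP (fun a => f a \notin F)) => [a faF | all]; last first.
  by exists f; split=> // a; have := all a => /negbFE.
have [[faF']|[_ ia ja Ba]] := shiftP (fF a); first by rewrite faF' in faF.
have others b : b != a -> f b \in F /\ (j \in f b -> swap i j (f b) \in F).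
  move=> nb; have ib : i \notin f b.
    by apply/negP=> ib; apply: (disjP _ _ i (fD b a nb)).
  case: (shiftP (fF b)) => [[h1 h2]|[_ ib']]; last by rewrite ib' in ib.
  by split=> // jb; apply: h2.
have sub A x : x \in swap i j A -> x = i \/ (x != j /\ x \in A).
  by rewrite !inE => /orP[/eqP|/andP[]]; auto.
have subA x : x \in swap j i (f a) -> x = j \/ (x != i /\ x \in f a).
  by rewrite !inE => /orP[/eqP|/andP[]]; auto.
(* The new member [f a] returns [i] and takes [j] back. If another member contains [j], it takes [i]
   instead: it is old and its move was blocked, so the swapped set is in [F]. *)
pose g b := if b == a then swap j i (f a) else
            if j \in f b then swap i j (f b) else f b.
exists g; split=> [b|b c nbc].
  rewrite /g; case: eqP => [_ //|/eqP nb].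
  by have [h1 h2] := others b nb; case: ifP.
wlog nc : b c nbc / c != a.
  move=> h; case: (eqVneq c a) => [ca|nc]; last exact: h.
  rewrite disjoint_sym; apply: h; first by rewrite eq_sym.
  by rewrite -ca.
have dA b' : b' != a -> [disjoint swap j i (f a) & g b'].
  move=> nb; rewrite /g (negbTE nb).
  apply/pred0P=> x /=; apply/negP=> /andP[/subA h1]; case: ifP => jb.
    move=> /sub h2; case: h1 h2 => [->|[h1 h1']] [h2|[h2 h2']].
    - by rewrite h2 eqxx in nij.
    - by rewrite eqxx in h2.
    - by rewrite h2 eqxx in h1.
    - exact: (disjP _ _ x (fD b' a nb)).
  case: h1 => [->|[h1 h1']] h2; first by rewrite h2 in jb.
  exact: (disjP _ _ x (fD b' a nb)).
rewrite {1}/g; case: eqP => [_|/eqP nb]; first exact: dA.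
rewrite /g (negbTE nc); have D := fD _ _ nbc.
have ni b' : b' != a -> i \notin f b'.
  by move=> nb'; apply/negP=> ib; apply: (disjP _ _ i (fD b' a nb')).
apply/pred0P=> x /=; apply/negP=> /andP[].
case: ifP => jb; case: ifP => jc; first by case: (disjP _ _ j D).
- case/sub=> [->|[_ xb]] xc; last exact: (disjP _ _ x D).
  by move: (ni c nc); rewrite xc.
- move=> xb /sub[xi|[_ xc]]; last exact: (disjP _ _ x D).
  by move: (ni b nb); rewrite -xi xb.
- by move=> xb xc; apply: (disjP _ _ x D).
Qed.

(** A member of [F] that does not survive the shift contains [j]. Thus a cover of size [s] created
    by a shift comes from a cover of size at most [s + 1]. *)
Lemma covers_shift S F i j : covers S (shift F i j) -> covers (j |: S) F.
Proof.
move=> /forall_inP c; apply/forall_inP=> A AF.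
case: (mem_shift_or i j AF) => [/c|[jA _ _]]; last first.
  by apply/set0Pn; exists j; rewrite !inE jA eqxx.
by case/set0Pn=> x; rewrite inE => /andP[xA xS]; apply/set0Pn; exists x;
  rewrite !inE xA xS orbT.
Qed.

End Shifting.

(** * Shadows *)

Section Shadows.
Variable T : finType.
Implicit Types (F H : {set {set T}}) (A B V : {set T}) (x y v : T).

Definition link x F := [set B : {set T} | (x \notin B) && (x |: B \in F)].

Definition shadow F := [set B : {set T} | [exists x, B \in link x F]].

Definition shift_closed (r : T -> nat) V F :=
  forall A i j, i \in V -> j \in V -> r i < r j ->
  A \in F -> j \in A -> i \notin A -> swap i j A \in F.

Lemma card_link x F : #|link x F| = #|[set A in F | x \in A]|.
Proof.
rewrite -(@card_in_imset _ _ (fun B => x |: B) (link x F)) => [|A B]; last first.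
  rewrite !inE => /andP[xA _] /andP[xB _] E.
  by rewrite -(setU1K xA) E setU1K.
apply: eq_card => A; rewrite inE; apply/imsetP/andP => [[B]|[AF xA]].
  by rewrite inE => /andP[xB xBF] ->; rewrite xBF !inE eqxx.
by exists (A :\ x); rewrite ?inE ?eqxx setD1K.
Qed.

(** Double counting of the pairs [(B, x)] with [x |: B] in [H]: every member has [k] points to
    delete, and every [B] in the shadow has at most [#|V| - (k - 1)] extensions inside [V]. *)
Lemma local_LYM V k H : 0 < k ->
  (forall A, A \in H -> (A \subset V) && (#|A| == k)) ->
  k * #|H| <= (#|V| - k.-1) * #|shadow H|.
Proof.
move=> k0 HV.
have -> : k * #|H| = \sum_x #|link x H|.
  transitivity (\sum_(A in H) \sum_(x in A) 1).
    rewrite mulnC -sum_nat_const; apply: eq_bigr => A /HV /andP[_ /eqP <-].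
    by rewrite sum1_card.
  rewrite (exchange_big_dep xpredT) //=; apply: eq_bigr => x _.
  rewrite card_link -sum1_card; apply: eq_bigl => A; by rewrite inE.
apply: (@leq_trans (\sum_(B in shadow H) \sum_(x | B \in link x H) 1)).
  rewrite [leqRHS](exchange_big_dep xpredT) //=; apply: leq_sum => x _.
  rewrite -sum1_card; apply: eq_leq; apply: eq_bigl => B.
  rewrite andbC; case h: (B \in link x H) => //=.
  by symmetry; rewrite inE; apply/existsP; exists x.
rewrite mulnC -sum_nat_const; apply: leq_sum => B; rewrite inE.
case/existsP=> x0; rewrite inE => /andP[x0B /HV /andP[sV /eqP c]].
rewrite sum1_card.
have cB : #|B| = k.-1 by rewrite -c cardsU1 x0B.
have BV : B \subset V by apply: subset_trans sV; rewrite subsetUr.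
have -> : #|V| - k.-1 = #|V :\: B| by rewrite cardsD (setIidPr BV) cB.
apply: subset_leq_card.
apply/subsetP=> x xB0; have : B \in link x H := xB0.
rewrite inE => /andP[xB /HV /andP[sx _]]; rewrite inE xB /=.
by rewrite (subsetP sx) // !inE eqxx.
Qed.

Lemma card_disjoint_sum m (f : 'I_m -> {set T}) :
  (forall a b, a != b -> [disjoint f a & f b]) ->
  #|\bigcup_a f a| = \sum_a #|f a|.
Proof.
move=> fD; rewrite -sum1_card partition_disjoint_bigcup //.
by apply: eq_bigr => a _; rewrite sum1_card.
Qed.

(** Frankl's shadow bound, by induction on the ground set [V]. A small [V] is settled by
    [local_LYM]; otherwise [H] is split at the [r]-largest point [v] into the members missing [v]
    and the link of [v]. *)
Lemma card_shadow (r : T -> nat) s V k H : injective r ->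
  (forall A, A \in H -> (A \subset V) && (#|A| == k)) ->
  shift_closed r V H -> ~ has_matching s.+1 H ->
  #|H| <= s * #|shadow H|.
Proof.
move=> rI.
(* For uniformity 0 the only possible member is the empty set, which repeated would be a matching of
   size [s + 1]. *)
have k0E V' k' H' : k' = 0 ->
    (forall A, A \in H' -> (A \subset V') && (#|A| == k')) ->
    ~ has_matching s.+1 H' -> #|H'| = 0.
  move=> -> HV Hm; case: (set_0Vmem H') => [->|[A AH]]; first exact: cards0.
  case: Hm; exists (fun=> A); split=> // a b _; move: (HV _ AH).
  by rewrite cards_eq0 => /andP[_ /eqP->]; rewrite -setI_eq0 set0I.
elim: {V}#|V| {-2}V (leqnn #|V|) k H => [|n IH] V Vn k H HV Hc Hm;
  case: (posnP k) => [k0|k0]; try by rewrite (k0E V k H).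
- case: (set_0Vmem H) => [->|[A AH]]; first by rewrite cards0.
  have /andP[/subset_leq_card] := HV _ AH; lia.
(* If [#|V| <= (s + 1) k - 1], then [#|V| - (k - 1) <= s k], and the factor [k] cancels. *)
case: (ltnP #|V| (s.+1 * k)) => Vk.
  rewrite -(leq_pmul2l k0); apply: leq_trans (local_LYM k0 HV) _.
  rewrite mulnA leq_mul2r; apply/orP; right; nia.
have V0 : 0 < #|V| by nia.
have [v0 v0V] : exists v, v \in V by apply/set0Pn; rewrite -card_gt0.
case: (arg_maxnP r v0V) => v vV0 vmax; have vV : v \in V := vV0.
have vlt x : x \in V -> x != v -> r x < r v.
  move=> xV nx; rewrite ltn_neqAle; apply/andP; split; last exact: vmax.
  by apply: contra_neq nx => /rI.
pose H0 := [set A in H | v \notin A].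
have cV : #|V :\ v| <= n by move: Vn; rewrite (cardsD1 v V) vV; lia.
have IH0 : #|H0| <= s * #|shadow H0|.
  apply: (IH (V :\ v) cV k) => [A|A i j|[f [fH fD]]].
  - rewrite inE => /andP[/HV/andP[AV ->] vA]; rewrite andbT.
    by rewrite subsetD1 AV.
  - rewrite !inE => /andP[ni iV] /andP[nj jV] rij /andP[AH vA] jA iA.
    rewrite (Hc A i j) //= negb_or negb_and vA orbT andbT.
    by rewrite eq_sym.
  - by apply: Hm; exists f; split=> // a; have := fH a; rewrite inE => /andP[].
have IH1 : #|link v H| <= s * #|shadow (link v H)|.
  apply: (IH (V :\ v) cV k.-1) => [A|A i j|[f [fH fD]]].
  - rewrite inE => /andP[vA /HV/andP[AV]]; rewrite cardsU1 vA => /eqP <-.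
    rewrite eqxx andbT subsetD1 vA andbT; apply: subset_trans AV.
    exact: subsetUr.
  - rewrite !inE => /andP[ni iV] /andP[nj jV] rij /andP[vA AH] jA iA.
    rewrite eq_sym negb_or ni /= (negbTE vA) andbF /=.
    have := Hc _ i j iV jV rij AH; rewrite !inE jA orbT (negbTE iA) orbF.
    move=> /(_ isT ni).
    suff -> : swap i j (v |: A) = v |: swap i j A by [].
    apply/setP=> x; rewrite !inE.
    by case: (x =P v) => [->|_] //=; rewrite (eq_sym v j) nj !orbT.
  - have cf a : #|f a| = k.-1.
      have := fH a; rewrite inE => /andP[vA /HV/andP[AV]].
      by rewrite cardsU1 vA => /eqP <-.
    (* A matching of [s + 1] sets in the link occupies [(s + 1)(k - 1)] points, which leaves [s + 1]
       free ones. Adding a different free point to each set, in place of [v], gives a matching in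
       [H] by shiftedness; one of the free points may be [v] itself. *)
    have cU : s.+1 <= #|V :\: \bigcup_a f a|.
      rewrite cardsD; have : #|V :&: \bigcup_a f a| <= s.+1 * k.-1.
        apply: leq_trans (subset_leq_card (subsetIr _ _)) _.
        rewrite card_disjoint_sum // (eq_bigr _ (fun a _ => cf a)).
        by rewrite sum_nat_const card_ord.
      nia.
    have yP (a : 'I_s.+1) : nth v (enum (V :\: \bigcup_a f a)) a
        \in V :\: \bigcup_a f a.
      by rewrite -mem_enum mem_nth // -cardE (leq_trans (ltn_ord a)).
    pose y (a : 'I_s.+1) := nth v (enum (V :\: \bigcup_a f a)) a.
    have yI a b : a != b -> y a != y b.
      move=> nab; rewrite /y nth_uniq ?enum_uniq -?cardE //;
        exact: leq_trans (ltn_ord _) _.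
    have yf a b : y a \notin f b.
      have := yP a; rewrite inE => /andP[h _]; apply: contra h => h.
      by apply/bigcupP; exists b.
    have yV a : y a \in V by have := yP a; rewrite inE => /andP[].
    apply: Hm; exists (fun a => y a |: f a); split=> [a|a b nab].
      have := fH a; rewrite inE => /andP[vA vH].
      case: (eqVneq (y a) v) => [->//|nv].
      have := Hc _ (y a) v (yV a) vV (vlt _ (yV a) nv) vH.
      rewrite !inE eqxx (negbTE nv) => /(_ isT (yf a a)).
      by rewrite /swap setU1K.
    apply/pred0P=> x /=; rewrite !inE; apply/negP=> /andP[].
    case/orP=> [/eqP->|xa] /orP[/eqP h|xb].
    + by move: (yI a b nab); rewrite h eqxx.
    + by rewrite (negbTE (yf a b)) in xb.
    + by move: (yf b a); rewrite -h xa.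
    + by have /pred0P/(_ x) := fD a b nab; rewrite /= xa xb.
have -> : #|H| = #|H0| + #|link v H|.
  rewrite card_link addnC -(cardsID [set A : {set T} | v \in A] H).
  by congr (_ + _); apply: eq_card => A; rewrite !inE ?(andbC (v \notin A)).
(* The two shadows embed disjointly into [shadow H]: the first as sets missing [v], the second,
   after adding [v], as sets containing it. *)
have : #|shadow H0| + #|shadow (link v H)| <= #|shadow H|.
  rewrite -(@card_in_imset _ _ (fun B => v |: B) (shadow (link v H))); last first.
    move=> A B; rewrite !inE => /existsP[x]; rewrite !inE negb_or.
    case/and3P=> _ /andP[_ vA] _ /existsP[z]; rewrite !inE negb_or.
    by case/and3P=> _ /andP[_ vB] _ E; rewrite -(setU1K vA) E setU1K.
  have dj : [disjoint shadow H0 & [set v |: B | B in shadow (link v H)]].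
    apply/pred0P=> A /=; apply/negP=> /andP[].
    rewrite inE => /existsP[x]; rewrite !inE negb_or => /and3P[_ _ /andP[_ vA]].
    by case/imsetP=> B _ E; rewrite E !inE eqxx in vA.
  rewrite -cardsUI (disjoint_setI0 dj) cards0 addn0; apply: subset_leq_card.
  rewrite subUset; apply/andP; split; apply/subsetP=> A.
    rewrite !inE => /existsP[x]; rewrite !inE => /and3P[xA xH _].
    by apply/existsP; exists x; rewrite inE xA.
  case/imsetP=> B; rewrite inE => /existsP[x].
  rewrite !inE negb_or => /and3P[xB /andP[nv vB] h] ->.
  apply/existsP; exists x; rewrite !inE negb_or eq_sym nv xB /=.
  by rewrite setUCA.
nia.
Qed.

End Shadows.

(** * Averaging over permutations *)

Section Averaging.
Variable T : finType.
Implicit Types (F H G : {set {set T}}) (A B C D V Y : {set T}) (x y v : T).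

Definition draws Y k := [set A : {set T} | (A \subset Y) && (#|A| == k)].

(** Transposing a point of [C :\: D] with one of [D :\: C] brings [C] closer to [D]. *)
Lemma perm_moving Y C D : C \subset Y -> D \subset Y -> #|C| = #|D| ->
  exists2 p : {perm T}, p \in Sym Y & p @: C = D.
Proof.
move=> CY DY; elim: {C}#|C :\: D| {-2}C (leqnn #|C :\: D|) CY => [|n IH] C Cn CY E.
  exists 1%g; first exact: group1.
  apply/eqP; rewrite imset_perm1 eqEcard -E leqnn andbT.
  by move: Cn; rewrite leqn0 cards_eq0 setD_eq0.
case: (set_0Vmem (C :\: D)) => [C0|[x]].
  by apply: IH; rewrite ?C0 ?cards0.
have E' : #|C :\: D| = #|D :\: C| by rewrite !cardsD E setIC.
move=> xCD; case: (set_0Vmem (D :\: C)) => [C0|[y]].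
  by move: E'; rewrite C0 cards0 (cardsD1 x) xCD.
move: (xCD); rewrite !inE => /andP[xD xC] /andP[yC yD].
have xY := subsetP CY _ xC; have yY := subsetP DY _ yD.
have tY : perm_on Y (tperm x y).
  by apply: subset_trans (tperm_on x y) _; rewrite subUset !sub1set xY yY.
have [|||p pY pE] := IH (tperm x y @: C).
- rewrite -ltnS; apply: leq_trans Cn.
  rewrite [ltnRHS](cardsD1 x) xCD add1n ltnS; apply: subset_leq_card.
  apply/subsetP=> z; rewrite inE => /andP[zD /imsetP[c cC zE]].
  rewrite !inE; move: zD; rewrite zE; case: tpermP => [_|cy|nx _] zD.
  - by rewrite yD in zD.
  - by rewrite -cy cC in yC.
  - by rewrite cC zD !andbT; apply/eqP.
- by rewrite -(im_perm_on tY) imsetS.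
- by rewrite card_imset //; exact: perm_inj.
exists (tperm x y * p)%g; first by rewrite groupM // inE.
by rewrite -pE -imset_comp; apply: eq_imset => z; rewrite permM.
Qed.

(** The image of [C] under a random element of [Sym Y] is uniform: composing with a permutation that
    carries [D'] to [D] matches the permutations sending [C] to [D'] with those sending it to
    [D]. *)
Lemma card_Sym_moving Y C D : C \subset Y -> D \subset Y -> #|D| = #|C| ->
  #|[set p in Sym Y | p @: C == D]| * 'C(#|Y|, #|C|) = #|Sym Y|.
Proof.
move=> CY DY E; rewrite -cards_draws mulnC -sum_nat_const.
have eqc D' : D' \in draws Y #|C| ->
    #|[set p in Sym Y | p @: C == D']| = #|[set p in Sym Y | p @: C == D]|.
  rewrite inE => /andP[D'Y /eqP cD'].
  have [|p pY pE] := perm_moving D'Y DY; first by rewrite E.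
  rewrite -(card_imset [set q in Sym Y | q @: C == D'] (mulIg p)).
  apply: eq_card => q; rewrite !inE; apply/imsetP/andP => [[q']|[qY /eqP qE]].
    rewrite !inE => /andP[q'Y /eqP q'E] ->.
    split; first by apply: perm_onM => //; move: pY; rewrite inE.
    rewrite -pE -q'E -imset_comp; apply/eqP/eq_imset => z; exact: permM.
  exists (q * p^-1)%g; last by rewrite mulgKV.
  rewrite !inE perm_onM ?perm_onV //=; last by move: pY; rewrite inE.
  apply/eqP; rewrite (_ : [set _ | _ in C] = p^-1%g @: (q @: C)); last first.
    by rewrite -imset_comp; apply: eq_imset => z; exact: permM.
  rewrite qE -pE -imset_comp -[RHS]imset_id; apply: eq_imset => z /=.
  by rewrite permK.
rewrite -(eq_bigr _ eqc) -[RHS]sum1_card.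
rewrite (partition_big (fun p : {perm T} => p @: C) (mem (draws Y #|C|))) /=.
  apply: eq_bigr => D' _; rewrite -sum1_card; apply: eq_bigl => p.
  by rewrite inE.
move=> p; rewrite !inE => pY; rewrite -{1}(im_perm_on pY) imsetS //=.
by rewrite card_imset //; exact: perm_inj.
Qed.

Lemma Sym_averaging Y C G : C \subset Y -> G \subset draws Y #|C| ->
  (\sum_(p in Sym Y) (p @: C \in G)) * 'C(#|Y|, #|C|) = #|G| * #|Sym Y|.
Proof.
move=> CY /subsetP GY.
have -> : \sum_(p in Sym Y) (p @: C \in G) =
    \sum_(D in G) #|[set p in Sym Y | p @: C == D]|.
  transitivity (\sum_(p in Sym Y) \sum_(D in G) (p @: C == D)).
    apply: eq_bigr => p _; case: (boolP (p @: C \in G)) => pG.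
      rewrite (bigD1 (p @: C)) //= eqxx big1 // => D /andP[_ nD].
      by rewrite eq_sym (negbTE nD).
    by rewrite big1 // => D DG; case: eqP => // E; rewrite E DG in pG.
  rewrite exchange_big; apply: eq_bigr => D _.
  rewrite -sum1_card big_mkcond [RHS]big_mkcond; apply: eq_bigr => p _.
  by rewrite !inE; case: perm_on => //=; case: eqP.
rewrite big_distrl -sum_nat_const; apply: eq_bigr => D /GY.
by rewrite inE => /andP[DY /eqP cD]; rewrite /= card_Sym_moving.
Qed.

(** Every [p @: C j] is a uniformly random [k]-subset of [Y], so taking expectations turns a bound
    valid for each [p] into one on the sizes [#|G i|]. Joint independence is not involved, and the
    blocks can be chosen disjoint. *)
Lemma averaging (I J : finType) (a : I -> J -> nat) (C : J -> {set T})
    (G : I -> {set {set T}}) Y k c :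
  (forall j, C j \subset Y) -> (forall j, #|C j| = k) ->
  (forall i, G i \subset draws Y k) ->
  (forall p : {perm T}, p \in Sym Y ->
    \sum_i \sum_j a i j * (p @: C j \in G i) <= c) ->
  \sum_i \sum_j a i j * #|G i| <= c * 'C(#|Y|, k).
Proof.
move=> CY Ck GY h.
have S0 : 0 < #|Sym Y| by exact: cardG_gt0.
rewrite -(leq_pmul2r S0) big_distrl /=.
have -> : \sum_i (\sum_j a i j * #|G i|) * #|Sym Y| =
   (\sum_(p in Sym Y) \sum_i \sum_j a i j * (p @: C j \in G i)) * 'C(#|Y|, k).
  rewrite exchange_big big_distrl; apply: eq_bigr => i _ /=.
  rewrite exchange_big !big_distrl; apply: eq_bigr => j _ /=.
  rewrite -mulnA -(@Sym_averaging Y (C j)) ?Ck // mulnA; congr (_ * _).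
  by rewrite big_distrr.
rewrite mulnAC leq_mul2r; apply/orP; right.
by rewrite mulnC -sum_nat_const; apply: leq_sum.
Qed.

Lemma disjoint_blocks m k Y : m * k <= #|Y| ->
  exists C : nat -> {set T},
    (forall j, j < m -> (C j \subset Y) /\ #|C j| = k) /\
    (forall i j, i < m -> j < m -> i != j -> [disjoint C i & C j]).
Proof.
elim: m Y => [|m IH] Y mY; first by exists (fun=> set0).
case: (set_0Vmem (draws Y k)) => [d0|[D]].
  have := cards_draws Y k; rewrite -/(draws Y k) d0 cards0.
  move=> /eqP; rewrite eq_sym eqn0Ngt bin_gt0 (leq_trans _ mY) //.
  by rewrite mulSn leq_addr.
rewrite inE => /andP[DY /eqP Dk].
have [|C [CY Cd]] := IH (Y :\: D).
  by move: mY; rewrite mulSn cardsD (setIidPr DY) Dk; clear; lia.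
have dD j : j < m -> [disjoint C j & D].
  by move=> /CY[]; rewrite subsetD => /andP[].
exists (fun j => if j == m then D else C j); split=> [j|i j].
  rewrite ltnS leq_eqVlt; case: eqP => //= _ /CY[h1 h2]; split=> //.
  exact: subset_trans h1 (subsetDl _ _).
rewrite !ltnS [i <= m]leq_eqVlt [j <= m]leq_eqVlt.
case: eqP => [->|_]; case: eqP => [->|_] //=.
- by rewrite eqxx.
- by move=> _ /dD; rewrite disjoint_sym.
- by move=> /dD.
- exact: Cd.
Qed.

End Averaging.

(* Greedily: [h p] only has to avoid the [p] representatives chosen before. *)
Lemma greedy_representatives (J : finType) (j0 : J) p (N : nat -> {set J}) :
  (forall i, i < p -> i < #|N i|) ->
  exists h : nat -> J, (forall i, i < p -> h i \in N i) /\
    (forall i j, i < p -> j < p -> i != j -> h i != h j).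
Proof.
elim: p => [|p IH] hN; first by exists (fun=> j0).
have [|h [h1 h2]] := IH; first by move=> i /ltnW; apply: hN.
have [j jN jh] : exists2 j, j \in N p & j \notin [set h i | i : 'I_p].
  have /card_gt0P[j] : 0 < #|N p :\: [set h i | i : 'I_p]|.
    rewrite cardsD subn_gt0; apply: leq_ltn_trans (hN p (ltnSn p)).
    apply: leq_trans (subset_leq_card (subsetIr _ _)) _.
    by apply: leq_trans (leq_imset_card _ _) _; rewrite card_ord.
  by rewrite inE => /andP[? ?]; exists j.
have hj i : i < p -> h i != j.
  move=> ip; apply: contraNneq jh => <-; apply/imsetP.
  by exists (Ordinal ip).
exists (fun i => if i == p then j else h i); split=> [i|i l].
  rewrite ltnS leq_eqVlt; case: eqP => [-> //|_ /=]; exact: h1.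
rewrite !ltnS [i <= p]leq_eqVlt [l <= p]leq_eqVlt.
case: eqP => [->|_]; case: eqP => [->|_] //=.
- by rewrite eqxx.
- by move=> _ /hj; rewrite eq_sym.
- by move=> /hj.
- exact: h2.
Qed.

(** * Links of the traces on an [s + 1]-set *)

(** The terms before [i0] are at most [m]; the others, of total weight
    [(s - i0) + (m - s) = m - i0], are at most [s - i0]. The sum is at most
    [i0 m + (s - i0)(m - i0)]. *)
Lemma weighted_chain_bound m s i0 (c : nat -> nat) :
  s <= m -> i0 <= s -> (forall i, c i <= m) ->
  (forall i, i0 <= i -> i <= s -> c i <= s - i0) ->
  \sum_(i < s) c i + (m - s) * c s <= s * m.
Proof.
move=> sm i0s cm ci.
have h1 : \sum_(i < s) c i <= i0 * m + (s - i0) * (s - i0).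
  rewrite -(big_mkord xpredT) (big_cat_nat (n := i0)) //=; apply: leq_add.
    rewrite -[X in X * m]subn0 -sum_nat_const_nat; exact: leq_sum.
  rewrite -sum_nat_const_nat big_nat_cond [leqRHS]big_nat_cond.
  by apply: leq_sum => i /andP[/andP[? /ltnW ?] _]; apply: ci.
apply: leq_trans (leq_add h1 (leq_mul (leqnn _) (ci s i0s (leqnn s)))) _.
rewrite -addnA -mulnDl -[X in _ <= X * _](subnKC i0s) [leqRHS]mulnDl leq_add2l.
by rewrite mulnC leq_mul2l; apply/orP; right; lia.
Qed.

Section Links.
Variables (T : finType) (s k : nat) (F : {set {set T}}) (u : nat -> T).
Hypothesis u_inj : forall i j, i <= s -> j <= s -> u i = u j -> i = j.
Hypothesis k_gt0 : 0 < k.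
Hypothesis F_uniform : F \subset ksets T k.
Hypothesis F_matching : ~ has_matching s.+1 F.
Let W := [set u i | i : 'I_s.+1].
Let Y := ~: W.
Definition trace_link i := [set B in link (u i) F | B \subset Y].
Notation G := trace_link.

Let uW i : i <= s -> u i \in W.
Proof. by move=> si; apply/imsetP; exists (Ordinal (si : i < s.+1)). Qed.

Let uY i (B : {set T}) : i <= s -> B \subset Y -> u i \notin B.
Proof.
by move=> si /subsetP BY; apply/negP=> /BY; rewrite inE (uW si).
Qed.

Lemma card_trace_support : #|W| = s.+1.
Proof.
rewrite card_imset ?card_ord // => i j /u_inj E; apply: ord_inj.
by apply: E; rewrite -ltnS.
Qed.

Lemma trace_link_draws i : G i \subset draws Y k.-1.
Proof.
apply/subsetP=> B; rewrite !inE => /andP[/andP[uB uF] BY].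
rewrite BY /=; have := subsetP F_uniform _ uF.
by rewrite inE cardsU1 uB => /eqP <-.
Qed.

Lemma trace_links_not_disjoint (B : nat -> {set T}) :
  (forall i, i <= s -> B i \in G i) ->
  (forall i j, i <= s -> j <= s -> i != j -> [disjoint B i & B j]) -> False.
Proof.
move=> BG BD; apply: F_matching.
exists (fun a => u a |: B a); split=> [a|a b nab].
  have := BG a; rewrite -ltnS => /(_ (ltn_ord a)).
  by rewrite !inE => /andP[/andP[]].
have sa : a <= s by rewrite -ltnS.
have sb : b <= s by rewrite -ltnS.
have BY i : i <= s -> B i \subset Y by move/BG; rewrite inE => /andP[].
apply/pred0P=> x /=; rewrite !inE; apply/negP=> /andP[].
case/orP=> [/eqP->|xa] /orP[/eqP h|xb].
- by move: nab; rewrite -val_eqE /= (u_inj sa sb h) eqxx.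
- by rewrite (negbTE (uY sa (BY b sb))) in xb.
- by rewrite h (negbTE (uY sb (BY a sa))) in xa.
- by have /pred0P/(_ x) := BD a b sa sb nab; rewrite /= xa xb.
Qed.

(** For each permutation, [N i] is the set of blocks falling into the link [G i]. If
    [#|N i| > s - i] for all [i], distinct blocks could be chosen in all links, giving a matching of
    size [s + 1]. So some [i0] fails, and nestedness passes its bound on to all later links. *)
Lemma trace_links_weighted_bound m :
  m * k.-1 <= #|Y| -> s <= m -> 0 < m ->
  (forall i j, i <= j -> j <= s -> G j \subset G i) ->
  \sum_(i < s) #|G i| + (m - s) * #|G s| <= s * 'C(#|Y|, k.-1).
Proof.
move=> mY sm m0 Gn; have [C [CY CD]] := disjoint_blocks mY.
pose a (i : 'I_s.+1) (j : 'I_m) := if i < s then 1 else m - s.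
have := @averaging T 'I_s.+1 'I_m a (fun j => C j) (fun i => G i) Y k.-1 (s * m).
have aE (c : nat -> nat) :
    \sum_(i < s.+1) (if i < s then 1 else m - s) * c i =
    \sum_(i < s) c i + (m - s) * c s.
  rewrite big_ord_recr /= ltnn; congr (_ + _); apply: eq_bigr => i _.
  by rewrite ltn_ord mul1n.
have -> : \sum_i \sum_j a i j * #|G i| =
    m * (\sum_(i < s) #|G i| + (m - s) * #|G s|).
  rewrite -(aE (fun i => #|G i|)) big_distrr; apply: eq_bigr => i _ /=.
  by rewrite sum_nat_const card_ord.
rewrite [s * m]mulnC -mulnA leq_pmul2l //; apply=> [j|j|i|p pY].
- by case: (CY j (ltn_ord j)).
- by case: (CY j (ltn_ord j)).
- exact: trace_link_draws.
pose N i := [set j : 'I_m | p @: C j \in G i].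
have NE i j : (j \in N i) = (p @: C j \in G i) by rewrite in_set.
rewrite (eq_bigr (fun i : 'I_s.+1 => (if i < s then 1 else m - s) * #|N i|)).
2: move=> i _; rewrite -big_distrr /= -sum1_card; congr (_ * _).
2: rewrite [RHS]big_mkcond; apply: eq_bigr => j _.
2: by rewrite NE; case: (_ \in _).
rewrite (aE (fun i => #|N i|)) [m * s]mulnC.
have [/existsP[i0 hi0]|] := boolP [exists i0 : 'I_s.+1, #|N i0| <= s - i0].
  apply: (@weighted_chain_bound m s i0 (fun i => #|N i|)) => // [|i|i i0i si].
  - by rewrite -ltnS.
  - by rewrite -[leqRHS](card_ord m) max_card.
  apply: leq_trans hi0; apply: subset_leq_card; apply/subsetP=> j.
  by rewrite !NE; have /subsetP := Gn _ _ i0i si; apply.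
rewrite negb_exists => /forallP hN; exfalso.
(* The choice starts from the smallest link: [N (s - i)] has more than [i] elements, as the greedy
   argument requires at stage [i]. *)
have [|h [hG hI]] :=
    @greedy_representatives 'I_m (Ordinal m0) s.+1 (fun i => N (s - i)).
  move=> i is1; have si : s - i < s.+1 by rewrite ltnS leq_subr.
  by have := hN (Ordinal si); rewrite /= -ltnNge subKn.
apply: (@trace_links_not_disjoint (fun i => p @: C (h (s - i)))) =>
  [i si|i j si sj nij].
  have := hG (s - i); rewrite ltnS leq_subr subKn // NE; exact.
rewrite imset_disjoint; last exact: perm_inj.
apply: CD => //; apply: hI; rewrite ?ltnS ?leq_subr //.
by apply: contra nij => /eqP E; rewrite -(subKn si) E subKn.
Qed.

(** Block [i] is tested against link [i] only, inside [Y] minus [B]. All [s] tests cannot succeed,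
    since together with [B] they would give disjoint sets in all [s + 1] links; so one full binomial
    coefficient is lost on average. *)
Lemma trace_links_deficit B : 0 < s -> B \in G s -> s * k.-1 <= #|Y| - k.-1 ->
  \sum_(i < s) #|G i| + 'C(#|Y| - k.-1, k.-1) <= s * 'C(#|Y|, k.-1).
Proof.
move=> s0 BG; have := subsetP (trace_link_draws s) _ BG.
rewrite inE => /andP[BY /eqP Bk] sY.
pose Y' := Y :\: B.
have cY' : #|Y'| = #|Y| - k.-1 by rewrite cardsD (setIidPr BY) Bk.
rewrite -cY' in sY *; have [C [CY CD]] := disjoint_blocks sY.
pose G' i := [set D in G i | D \subset Y'].
have G'd i : G' i \subset draws Y' k.-1.
  apply/subsetP=> D; rewrite inE => /andP[/(subsetP (trace_link_draws i)) DD DY'].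
  by move: DD; rewrite !inE DY' => /andP[].
(* The members of [G i] that meet [B] are bounded trivially, by all [(k - 1)]-subsets of [Y] that
   meet [B]. *)
have step i : #|G i| + 'C(#|Y'|, k.-1) <= #|G' i| + 'C(#|Y|, k.-1).
  rewrite -!cards_draws -/(draws Y k.-1) -/(draws Y' k.-1).
  rewrite -(cardsID (draws Y' k.-1) (draws Y k.-1)).
  rewrite (setIidPr _); last first.
    apply/subsetP=> D; rewrite !inE => /andP[DY ->]; rewrite andbT.
    exact: subset_trans DY (subsetDl _ _).
  rewrite addnCA addnC leq_add2l -(cardsID [set D : {set T} | D \subset Y'] (G i)).
  rewrite (_ : G i :&: _ = G' i) ?leq_add2l; last first.
    by apply/setP=> D; rewrite !inE.
  apply: subset_leq_card; apply/subsetP=> D.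
  rewrite !in_setD => /andP[DY' /(subsetP (trace_link_draws i)) DD].
  by rewrite DD andbT; move: DY'; rewrite !inE => /negbTE ->.
have avg : \sum_(i < s) #|G' i| <= s.-1 * 'C(#|Y'|, k.-1).
  have := @averaging T 'I_s 'I_s (fun i j => i == j) (fun j => C j)
    (fun i => G' i) Y' k.-1 s.-1.
  have dg (c : 'I_s -> 'I_s -> nat) :
      \sum_i \sum_j (i == j) * c i j = \sum_i c i i.
    apply: eq_bigr => i _; rewrite (bigD1 i) //= eqxx mul1n big1 ?addn0 // => j.
    by rewrite eq_sym => /negbTE ->.
  rewrite (dg (fun i j => #|G' i|)); apply=> [j|j|i|p pY].
  - by case: (CY j (ltn_ord j)).
  - by case: (CY j (ltn_ord j)).
  - exact: G'd.
  rewrite (dg (fun i j : 'I_s => (p @: C j \in G' i) : nat)).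
  rewrite -ltnS prednK //.
  have [/forallP hall|] := boolP [forall i : 'I_s, p @: C i \in G' i]; last first.
    rewrite negb_forall => /existsP[i hi].
    rewrite (bigD1 i) //= (negbTE hi) add0n.
    apply: leq_ltn_trans (_ : \sum_(j < s | j != i) 1 < s).
      by apply: leq_sum => j _; case: (_ \in _).
    by rewrite sum1_card cardC1 card_ord prednK.
  exfalso; apply: (@trace_links_not_disjoint
      (fun i => if i < s then p @: C i else B)) => [i|i j].
    rewrite leq_eqVlt => /orP[/eqP->|si]; first by rewrite ltnn.
    by rewrite si; have := hall (Ordinal si); rewrite inE => /andP[].
  have dB l : l < s -> [disjoint p @: C l & B].
    move=> ls; have := hall (Ordinal ls); rewrite inE => /andP[_].
    by rewrite subsetD => /andP[].
  move=> si sj nij; case: ifP => his; case: ifP => hjs.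
  - rewrite imset_disjoint; last exact: perm_inj.
    exact: CD.
  - exact: dB.
  - by rewrite disjoint_sym dB.
  - by move: nij si sj his hjs; clear; lia.
have : \sum_(i < s) (#|G i| + 'C(#|Y'|, k.-1)) <=
       \sum_(i < s) (#|G' i| + 'C(#|Y|, k.-1)) by apply: leq_sum.
rewrite !big_split /= !sum_nat_const card_ord.
case: s s0 avg => // s' _ /=; rewrite !mulSn.
move: (\sum_(i < _) _) (\sum_(i < _) _) (s' * _) (s' * _) => *; lia.
Qed.

(** Counts the [k]-sets missing from [F], keeping only those whose trace on [W] is empty or a single
    point; sets with larger traces are allowed to be all in [F]. The inequality is arranged to avoid
    subtraction. *)
Lemma card_by_trace :
  #|F| + s.+1 * 'C(#|Y|, k.-1) + 'C(#|Y|, k) <=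
  'C(#|T|, k) + \sum_(i < s.+1) #|G i| + #|[set A in F | A \subset Y]|.
Proof.
have cK : #|ksets T k| = 'C(#|T|, k).
  rewrite -[in RHS]cardsT -cards_draws; apply: eq_card => A.
  by rewrite !inE subsetT.
pose M := ksets T k :\: F.
have cM : #|F| + #|M| = 'C(#|T|, k).
  by rewrite -cK -(cardsID F (ksets T k)) (setIidPr F_uniform).
have traceE A i : i <= s -> A :&: W == [set u i] -> u i \in A.
  by move=> si /eqP/setP/(_ (u i)); rewrite !inE eqxx => /andP[].
have h1 : \sum_(i < s.+1) #|[set A in M | A :&: W == [set u i]]| +
    #|[set A in M | A \subset Y]| <= #|M|.
  have E (P : pred {set T}) : #|[set A in M | P A]| = \sum_(A in M) P A.
    rewrite -sum1_card (eq_bigl (fun A => (A \in M) && P A)); last first.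
      by move=> A; rewrite inE.
    by rewrite big_mkcondr; apply: eq_bigr => A _; case: (P A).
  rewrite (eq_bigr _ (fun (i : 'I_s.+1) _ => E (fun A => A :&: W == [set u i]))).
  rewrite E exchange_big -big_split -sum1_card /=; apply: leq_sum => A _.
  have [AY|AY] := boolP (A \subset Y).
    rewrite big1 // => i _; apply/eqP; rewrite eqb0; apply/negP.
    have si : i <= s by rewrite -ltnS.
    by move=> /(traceE _ _ si); rewrite (negbTE (uY si AY)).
  rewrite addn0; have [/existsP[i hi]|] :=
    boolP [exists i : 'I_s.+1, A :&: W == [set u i]]; last first.
    by rewrite negb_exists => /forallP h; rewrite big1 // => i _;
      rewrite (negbTE (h i)).
  rewrite (bigD1 i) //= hi big1 // => j nji; apply/eqP; rewrite eqb0.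
  apply: contra nji; rewrite (eqP hi) eq_sym => /eqP/setP/(_ (u j)).
  rewrite !inE eqxx => /esym/eqP; move/eqP/eqP=> /u_inj E'; apply/eqP/ord_inj.
  by apply: E'; rewrite -ltnS.
have h2 (i : 'I_s.+1) : 'C(#|Y|, k.-1) <=
    #|G i| + #|[set A in M | A :&: W == [set u i]]|.
  have si : i <= s by rewrite -ltnS.
  rewrite -cards_draws -/(draws Y k.-1) -(cardsID (G i) (draws Y k.-1)).
  rewrite (setIidPr (trace_link_draws i)) leq_add2l.
  rewrite -(@card_in_imset _ _ (fun B => u i |: B)) => [|B B']; last first.
    rewrite !inE => /andP[_ /andP[BY _]] /andP[_ /andP[B'Y _]] E.
    by rewrite -(setU1K (uY si BY)) E setU1K // uY.
  apply: subset_leq_card; apply/subsetP=> A /imsetP[B].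
  rewrite !inE => /andP[nG /andP[BY /eqP Bk]] ->{A}; rewrite ?inE.
  move: nG; rewrite BY (uY si BY) /= andbT => -> /=.
  rewrite cardsU1 (uY si BY) Bk add1n prednK // eqxx /=.
  apply/eqP/setP=> x; rewrite !inE; case: (x =P u i) => [->|_] /=.
    by rewrite (uW si).
  by apply/negP=> /andP[/(subsetP BY)]; rewrite inE => /negbTE ->.
have h3 : 'C(#|Y|, k) <=
    #|[set A in F | A \subset Y]| + #|[set A in M | A \subset Y]|.
  rewrite -cards_draws -/(draws Y k) -(cardsID F (draws Y k)).
  apply: leq_add; apply: subset_leq_card; apply/subsetP=> A; rewrite !inE.
    by move=> /andP[/andP[-> _] ->].
  by move=> /andP[-> /andP[-> ->]].
have : \sum_(i < s.+1) 'C(#|Y|, k.-1) <=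
   \sum_(i < s.+1) (#|G i| + #|[set A in M | A :&: W == [set u i]]|).
  by apply: leq_sum => i _.
rewrite big_split /= sum_nat_const card_ord.
move: (s.+1 * _) => N; move: h1 h3 cM; clear.
set g := \sum_(i < s.+1) #|G i|; set e := \sum_(i < s.+1) _.
move: #|[set A in M | A \subset Y]| #|[set A in F | A \subset Y]| #|M| #|F|.
move: 'C(#|Y|, k) 'C(#|T|, k) g e => *; lia.
Qed.

End Links.

(** * Families without a cover of size [s] *)

Section Stability.
Variables (T : finType) (s k : nat).
Implicit Types (F : {set {set T}}) (A B S W : {set T}) (x y i j : T).
Hypothesis s_gt0 : 0 < s.
Hypothesis k_ge : 3 * s <= k.
Hypothesis T_large : 2 * k * k.-1 + s.+1 <= #|T|.

Let k_gt0 : 0 < k. Proof. lia. Qed.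

(* [2 * k] is the number of disjoint blocks of size [k - 1] that are averaged
   over in the complement of an [s + 1]-set. *)
Definition stability_bound F :=
  #|F| * (2 * k - s) + 'C(#|T| - s - k, k.-1) * (2 * k - 2 * s - 1)
    + (2 * k - s) * 'C(#|T| - s, k) <= (2 * k - s) * 'C(#|T|, k).

(** The weighted bound is taken [s + 1] times and the deficit bound [2 k - 2 s - 1] times, for a
    total weight [2 k - s]. This controls the first [s] links plus [s + 1] times the last one, which
    is what [card_by_trace] produces once [H] is bounded by [s] times the last link. *)
Lemma bound_of_nested_links F (u : nat -> T) (W := [set u a | a : 'I_s.+1]) :
  (forall a b, a <= s -> b <= s -> u a = u b -> a = b) ->
  F \subset ksets T k -> ~ has_matching s.+1 F ->
  (forall a b A, a < b -> b <= s -> A \in F -> u b \in A -> u a \notin A ->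
     swap (u a) (u b) A \in F) ->
  trace_link s F u s != set0 ->
  #|[set A in F | A \subset ~: W]| <= s * #|trace_link s F u s| ->
  stability_bound F.
Proof.
move=> u_inj FK Fm Fc /set0Pn[B BG] hH.
have cY : #|~: W| = #|T| - s.+1 by rewrite cardsCs setCK (card_trace_support u_inj).
have nested a b : a <= b -> b <= s ->
    trace_link s F u b \subset trace_link s F u a.
  rewrite leq_eqVlt => /orP[/eqP->|ab] // bs; apply/subsetP=> D.
  rewrite !inE => /andP[/andP[bD bF] DW]; rewrite DW andbT.
  have as_ : a <= s := leq_trans (ltnW ab) bs.
  have aD : u a \notin D.
    apply/negP=> /(subsetP DW); rewrite inE => /imsetP[].
    by exists (Ordinal (as_ : a < s.+1)).
  rewrite aD /=; have := Fc _ _ _ ab bs bF; rewrite !inE eqxx (negbTE aD) orbF.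
  rewrite /swap setU1K //; apply=> //.
  apply/negP=> /eqP/(u_inj _ _ as_ bs) E; by rewrite E ltnn in ab.
have ha := trace_links_weighted_bound u_inj FK Fm (m := 2 * k) _ _ _ nested.
have hb := trace_links_deficit u_inj k_gt0 FK Fm s_gt0 BG.
have hd := card_by_trace u_inj k_gt0 FK.
rewrite -/W cY in ha hb hd.
have {}ha : \sum_(i < s) #|trace_link s F u i| + (2 * k - s) * #|trace_link s F u s|
    <= s * 'C(#|T| - s.+1, k.-1).
  apply: ha; move: T_large; lia.
have {}hb : \sum_(i < s) #|trace_link s F u i| + 'C(#|T| - s - k, k.-1) <=
    s * 'C(#|T| - s.+1, k.-1).
  have E : #|T| - s.+1 - k.-1 = #|T| - s - k by lia.
  rewrite E in hb; apply: hb; rewrite -E; move: T_large; nia.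
have pascal : 'C(#|T| - s, k) = 'C(#|T| - s.+1, k) + 'C(#|T| - s.+1, k.-1).
  have -> : #|T| - s = (#|T| - s.+1).+1 by move: T_large; lia.
  by rewrite -{1 2}(prednK k_gt0) binS.
rewrite /stability_bound pascal; move: hd ha hb; rewrite big_ord_recr /=.
move: (\sum_(i < s) _) 'C(_, _) 'C(_, _) hH => S.
move: #|trace_link s F u s| #|[set A in F | A \subset ~: W]| #|F| => g h f.
have [p kE] : exists p, 2 * k = p + (2 * s).+1 by exists (2 * k - (2 * s).+1); lia.
have -> : 2 * k - s = p + s.+1 by lia.
have -> : 2 * k - 2 * s - 1 = p by lia.
clear; nia.
Qed.
Let r x := index x (enum T).

Let r_inj : injective r.
Proof.
move=> x y E; rewrite -(nth_index x (mem_enum T x)) -/(r x) E.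
by rewrite nth_index // mem_enum.
Qed.

Let r_total x y : x != y -> (r x < r y) || (r y < r x).
Proof. by move=> nxy; rewrite -neq_ltn; apply: contra_neq nxy => /r_inj. Qed.

(* Take a pair of sets, one in each link, with largest intersection: if they
   differ, a shift inside [~: W] brings one of them closer to the other. *)
Lemma common_link F W x y B B' : F \subset ksets T k ->
  (forall A i j, i \notin W -> j \notin W -> r i < r j ->
     A \in F -> j \in A -> i \notin A -> swap i j A \in F) ->
  x \in W -> y \in W ->
  B \subset ~: W -> x |: B \in F -> B' \subset ~: W -> y |: B' \in F ->
  exists D : {set T}, [/\ D \subset ~: W, x |: D \in F & y |: D \in F].
Proof.
move=> FK Fc xW yW.
have notW z (D : {set T}) : z \in W -> D \subset ~: W -> z \notin D.
  by move=> zW DW; apply/negP=> /(subsetP DW); rewrite inE zW.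
have card_in z (D : {set T}) : z \in W -> D \subset ~: W -> z |: D \in F -> #|D| = k.-1.
  move=> zW DW /(subsetP FK); rewrite inE cardsU1 (notW z D zW DW).
  by move=> /eqP <-.
have shiftW z (D : {set T}) i j : z \in W -> D \subset ~: W -> z |: D \in F ->
    i \notin W -> j \notin W -> r i < r j -> j \in D -> i \notin D ->
    swap i j D \subset ~: W /\ z |: swap i j D \in F.
  move=> zW DW zF iW jW rij jD iD; split.
    rewrite subUset sub1set inE iW /=; exact: subset_trans (subsetDl _ _) DW.
  have zi : z != i by apply: contraNneq iW => <-.
  have zj : z != j by apply: contraNneq jW => <-.
  have := Fc _ _ _ iW jW rij zF; rewrite !inE jD orbT (negbTE iD) orbF eq_sym.
  move=> /(_ isT zi).
  suff -> : swap i j (z |: D) = z |: swap i j D by [].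
  apply/setP=> v; rewrite !inE; case: (v =P z) => [->|_] //=.
  by rewrite zj orbT.
have [n] := ubnP #|B :\: B'|; elim: n B B' => // n IH B B' Bn BW xB BW' yB'.
have E : #|B| = #|B'| by rewrite (card_in x B) // (card_in y B').
case: (set_0Vmem (B :\: B')) => [/eqP|[a aB]].
  rewrite setD_eq0 => sB; exists B'; split=> //.
  by have <- : B = B' by apply/eqP; rewrite eqEcard sB E leqnn.
have E' : #|B :\: B'| = #|B' :\: B| by rewrite !cardsD E setIC.
case: (set_0Vmem (B' :\: B)) => [D0|[b bB]].
  by move: E'; rewrite D0 cards0 (cardsD1 a) aB.
move: (aB) (bB); rewrite !inE => /andP[aB' aBB] /andP[bB' bBB].
have aW : a \notin W by have := subsetP BW _ aBB; rewrite inE.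
have bW : b \notin W by have := subsetP BW' _ bBB; rewrite inE.
have closer : #|(B :\: B') :\ a| < n.
  by move: Bn; rewrite (cardsD1 a) aB.
have [|rab|rba] := orP (@r_total a b _).
- by apply: contraNneq bB' => <-.
- have [h1 h2] := shiftW _ _ _ _ yW BW' yB' aW bW rab bBB aB'.
  apply: (IH B (swap a b B')) => //; apply: leq_ltn_trans closer.
  apply: subset_leq_card; apply/subsetP=> z; rewrite !inE negb_or negb_and negbK.
  case/andP=> /andP[-> /orP[/eqP->|->]] //=.
  by rewrite (negbTE bB').
- have [h1 h2] := shiftW _ _ _ _ xW BW xB bW aW rba aBB bB'.
  apply: (IH (swap b a B) B') => //; apply: leq_ltn_trans closer.
  apply: subset_leq_card; apply/subsetP=> z; rewrite !inE.
  case/andP=> zB' /orP[/eqP zb|/andP[-> ->]]; last by rewrite zB'.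
  by rewrite zb bBB in zB'.
Qed.

(** Induction on the weight, with shifts that keep [W] a minimal cover. When none is left, the links
    are nested, and no member misses [W]. *)
Lemma bound_of_minimal_cover F W : F \subset ksets T k ->
  ~ has_matching s.+1 F -> #|W| = s.+1 -> covers W F ->
  (forall x, x \in W -> exists2 A, A \in F & A :&: W = [set x]) ->
  stability_bound F.
Proof.
move=> + + cW; have [n] := ubnP (weight r F).
elim: n F => // n IH F Fn FK Fm Fcov Ftr.
have IH' i j : r i < r j -> shift F i j != F -> covers W (shift F i j) ->
    (forall x, x \in W -> exists2 A, A \in shift F i j & A :&: W = [set x]) ->
    stability_bound F.
  move=> rij nF h1 h2; have wlt := weight_shift rij nF.
  suff : stability_bound (shift F i j) by rewrite /stability_bound card_shift.
  apply: IH => //; first by apply: leq_trans wlt _; rewrite -ltnS.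
    exact: shift_uniform.
  move=> /shift_has_matching h; apply: Fm; apply: h.
  by apply: contraTneq rij => ->; rewrite ltnn.
have meet A x : A \in F -> A :&: W = [set x] ->
    forall z, z \in A -> z \in W -> z = x.
  by move=> _ E z zA zW; apply/set1P; rewrite -E inE zA.
(* Shifts between points outside [W] leave all traces on [W] unchanged. They are exhausted first,
   because [common_link] relies on stability under them. *)
have [/existsP[i /existsP[j /and4P[iW jW rij nF]]]|Yc] := boolP
  [exists i, exists j, [&& i \notin W, j \notin W, r i < r j & shift F i j != F]].
  have swW A : swap i j A :&: W = A :&: W.
    apply/setP=> x; rewrite !inE; case: (x =P i) => [->|_] /=.
      by rewrite (negbTE iW) andbF.
    by case: (x =P j) => [->|_] //=; rewrite (negbTE jW) andbF.
  have swW' A : swap j i A :&: W = A :&: W.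
    apply/setP=> x; rewrite !inE; case: (x =P j) => [->|_] /=.
      by rewrite (negbTE jW) andbF.
    by case: (x =P i) => [->|_] //=; rewrite (negbTE iW) andbF.
  apply: (IH' i j) => // [|x xW].
    apply/forall_inP=> A /shiftP[[AF _]|[_ _ _ AF]].
      exact: (forall_inP Fcov).
    by rewrite -(swW' A); apply: (forall_inP Fcov).
  have [A AF Ax] := Ftr x xW.
  case: (mem_shift_or i j AF) => [?|[_ _ ?]]; first by exists A.
  by exists (swap i j A); rewrite ?swW.
have {}Yc A i j : i \notin W -> j \notin W -> r i < r j -> A \in F ->
    j \in A -> i \notin A -> swap i j A \in F.
  move=> iW jW rij; apply: shift_fixed; apply: contraNeq Yc => nF.
  by apply/existsP; exists i; apply/existsP; exists j; rewrite iW jW rij.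
have linkP x : x \in W ->
    exists2 B : {set T}, B \subset ~: W & x |: B \in F.
  move=> xW; have [A AF Ax] := Ftr x xW.
  have xA : x \in A by have : x \in A :&: W by [rewrite Ax inE]; rewrite inE => /andP[].
  exists (A :\ x); last by rewrite setD1K.
  apply/subsetP=> z; rewrite !inE => /andP[nz zA].
  by apply: contraNN nz => /(meet A x AF Ax _ zA) ->.
have [/existsP[i /existsP[j /and4P[iW jW rij nF]]]|Wc] := boolP
  [exists i, exists j, [&& i \in W, j \in W, r i < r j & shift F i j != F]].
  apply: (IH' i j) => // [|x xW].
    apply/forall_inP=> A /shiftP[[AF _]|[_ iA _ AF]].
      exact: (forall_inP Fcov).
    by apply/set0Pn; exists i; rewrite inE iA.
  have [xj|nxj] := eqVneq x j; last first.
    have [A AF Ax] := Ftr x xW; exists A => //; apply: mem_shift_id => //.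
    by apply/orP; left; apply: contra nxj => /(meet A x AF Ax) ->.
  (* The member witnessing that [j] is essential could be moved. A set [D] common to the links of
     [i] and [j] replaces it: [j |: D] stays, being blocked by [i |: D]. *)
  have [B BW iB] := linkP i iW; have [B' BW' jB'] := linkP j jW.
  have [D [DW iD jD]] := common_link FK Yc iW jW BW iB BW' jB'.
  have nD z : z \in W -> z \notin D.
    by move=> zW; apply/negP=> /(subsetP DW); rewrite inE zW.
  exists (j |: D).
    by apply: mem_shift_both => //; rewrite /swap setU1K // nD.
  apply/setP=> z; rewrite xj !inE; case: (z =P j) => [->|_] /=; first by rewrite jW.
  by apply/negP=> /andP[/(subsetP DW)]; rewrite inE => /negP.
have {}Wc A i j : i \in W -> j \in W -> r i < r j -> A \in F ->
    j \in A -> i \notin A -> swap i j A \in F.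
  move=> iW jW rij; apply: shift_fixed; apply: contraNeq Wc => nF.
  by apply/existsP; exists i; apply/existsP; exists j; rewrite iW jW rij.
have [w0 w0W] : exists w0, w0 \in W by apply/card_gt0P; rewrite cW.
(* Enumerating [W] in increasing [r] makes the shifts inside [W] go from later to earlier indices,
   as nestedness needs. *)
pose L := sort (relpre r leq) (enum W).
have Lsz : size L = s.+1 by rewrite size_sort -cardE.
have LW z : (z \in L) = (z \in W) by rewrite mem_sort mem_enum.
have Lu : uniq L by rewrite sort_uniq enum_uniq.
pose u a := nth w0 L a.
have uW a : a <= s -> u a \in W by move=> sa; rewrite -LW mem_nth // Lsz.
have u_inj a b : a <= s -> b <= s -> u a = u b -> a = b.
  by move=> sa sb /eqP; rewrite nth_uniq ?Lsz // => /eqP.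
have u_lt a b : a < b -> b <= s -> r (u a) < r (u b).
  move=> ab bs; rewrite ltn_neqAle; apply/andP; split.
    apply/eqP=> /r_inj/(u_inj _ _ (leq_trans (ltnW ab) bs) bs) E.
    by rewrite E ltnn in ab.
  have tr : transitive (relpre r leq) by move=> ? ? ? /=; apply: leq_trans.
  have so : sorted (relpre r leq) L by apply: sort_sorted => ? ?; apply: leq_total.
  apply: (sorted_ltn_nth tr w0 so); rewrite ?inE ?Lsz //.
  by rewrite ltnS (leq_trans (ltnW ab)).
have WE : [set u a | a : 'I_s.+1] = W.
  apply/eqP; rewrite eqEcard cW card_trace_support // leqnn andbT.
  by apply/subsetP=> _ /imsetP[a _ ->]; rewrite uW // -ltnS.
apply: (bound_of_nested_links u_inj) => //.
- move=> a b A ab bs; apply: Wc; rewrite ?uW ?u_lt //.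
  exact: leq_trans (ltnW ab) bs.
- have [B BW uB] := linkP _ (uW s (leqnn s)).
  apply/set0Pn; exists B; rewrite !inE WE BW uB !andbT.
  by apply/negP=> /(subsetP BW); rewrite inE uW.
- rewrite WE (_ : [set _ in F | _] = set0) ?cards0 //.
  apply/setP=> A; rewrite !inE; apply/negP=> /andP[/(forall_inP Fcov)].
  by rewrite setI_eq0 disjoints_subset => /negP.
Qed.

(** Induction on the weight: a shift either creates a cover of size [s], and then the family before
    the shift has a minimal cover of size [s + 1], or it keeps all hypotheses. What remains is the
    fully shifted case. *)
Theorem uncovered_family_bound F : F \subset ksets T k ->
  ~ has_matching s.+1 F -> (forall S, #|S| = s -> ~~ covers S F) ->
  stability_bound F.
Proof.
have [n] := ubnP (weight r F).
elim: n F => // n IH F Fn FK Fm Fcov.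
have [/existsP[i /existsP[j /andP[rij nF]]]|Fc] := boolP
  [exists i, exists j, (r i < r j) && (shift F i j != F)].
  have [/existsP[S /andP[/eqP cS Scov]]|nS] := boolP
      [exists S : {set T}, (#|S| == s) && covers S (shift F i j)].
    have Wcov := covers_shift Scov.
    have jS : j \notin S.
      apply: contraL Wcov => jS; rewrite (setUidPr _) ?sub1set //; exact: Fcov.
    have cW : #|j |: S| = s.+1 by rewrite cardsU1 jS cS.
    apply: (bound_of_minimal_cover FK Fm cW) => // x xW.
    (* Minimality: removing [x] leaves [s] points, which miss some member; that member meets the
       cover in [x] alone. *)
    have /Fcov : #|(j |: S) :\ x| = s.
      by move: cW; rewrite (cardsD1 x) xW => -[].
    rewrite negb_forall_in => /exists_inP[A AF]; rewrite negbK => /eqP A0.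
    exists A => //; apply/setP=> z; rewrite in_set1.
    have /set0Pn[y] := forall_inP Wcov _ AF.
    have uniq_x v : v \in A :&: (j |: S) -> v = x.
      rewrite inE => /andP[vA vW]; apply/eqP/negPn/negP=> nv.
      by have := in_set0 v; rewrite -A0 in_setI vA in_setD1 nv vW.
    move=> yAW; have yx := uniq_x _ yAW.
    apply/idP/eqP => [/uniq_x //|->]; by rewrite -yx.
  have wlt := weight_shift rij nF.
  suff : stability_bound (shift F i j) by rewrite /stability_bound card_shift.
  apply: IH => [||/shift_has_matching h|S cS].
  - by apply: leq_trans wlt _; rewrite -ltnS.
  - exact: shift_uniform.
  - by apply: Fm; apply: h; apply: contraTneq rij => ->; rewrite ltnn.
  - by apply: contraNN nS => h; apply/existsP; exists S; rewrite cS eqxx.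
have {}Fc A i j : r i < r j -> A \in F ->
    j \in A -> i \notin A -> swap i j A \in F.
  move=> rij; apply: shift_fixed; apply: contraNeq Fc => nF.
  by apply/existsP; exists i; apply/existsP; exists j; rewrite rij.
have Ts : s < #|T| by move: T_large; lia.
have /card_gt0P[x0 _] : 0 < #|T| by apply: leq_ltn_trans Ts.
pose u a := nth x0 (enum T) a.
have ru a : a <= s -> r (u a) = a.
  by move=> sa; rewrite /r index_uniq ?enum_uniq // -cardE (leq_ltn_trans sa).
have ur x : u (r x) = x by rewrite /u nth_index // mem_enum.
have u_inj a b : a <= s -> b <= s -> u a = u b -> a = b.
  by move=> sa sb E; rewrite -(ru a sa) E ru.
set W := [set u a | a : 'I_s.+1].
have uW a : a <= s -> u a \in W.
  by move=> sa; apply/imsetP; exists (Ordinal (sa : a < s.+1)).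
have rW x : x \notin W -> s < r x.
  by apply: contraR; rewrite -leqNgt => /uW; rewrite ur.
pose H := [set A in F | A \subset ~: W].
(* A point outside [W] comes after [u s] in the order, so in a member missing [W] any point can be
   exchanged for [u s]. *)
have shadowG : shadow H \subset trace_link s F u s.
  apply/subsetP=> B; rewrite inE => /existsP[x].
  rewrite !inE => /andP[xB /andP[xF]]; rewrite -/W subUset sub1set inE.
  case/andP=> xW BW; rewrite BW andbT.
  have sB : u s \notin B by apply/negP=> /(subsetP BW); rewrite inE uW.
  rewrite sB /=; have := Fc _ (u s) x _ xF; rewrite (ru s) // => /(_ (rW x xW)).
  rewrite !inE eqxx (negbTE sB) orbF /swap setU1K //; apply=> //.
  by apply: contraNneq xW => <-; apply: uW.
apply: (bound_of_nested_links u_inj) => //.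
- move=> a b A ab bs; apply: Fc; rewrite !ru //.
  exact: leq_trans (ltnW ab) bs.
(* A member missed by [W :\ u s] either contains [u s], and gives an element of the last link
   directly, or misses [W], and then its shadow does. *)
- have /Fcov : #|W :\ u s| = s.
    have := card_trace_support u_inj; rewrite -/W (cardsD1 (u s)) uW //.
    by case.
  rewrite negb_forall_in => /exists_inP[A AF]; rewrite negbK => /eqP A0.
  have AW z : z \in A -> z \in W -> z = u s.
    move=> zA zW; apply/eqP/negPn/negP=> nz.
    by have := in_set0 z; rewrite -A0 in_setI zA in_setD1 nz zW.
  have [sA|sA] := boolP (u s \in A).
    apply/set0Pn; exists (A :\ u s); rewrite !inE eqxx /= setD1K // AF /=.
    apply/subsetP=> z; rewrite !inE => /andP[nz zA].
    by apply: contra nz => /(AW _ zA) ->.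
  have AH : A \in H.
    rewrite inE AF; apply/subsetP=> z zA; rewrite inE.
    by apply/negP=> /(AW _ zA) E; rewrite -E zA in sA.
  have [x xA] : exists x, x \in A.
    apply/card_gt0P; have := subsetP FK _ AF; rewrite inE => /eqP ->.
    exact: k_gt0.
  apply/set0Pn; exists (A :\ x); apply: (subsetP shadowG); rewrite inE.
  by apply/existsP; exists x; rewrite inE setD1K // AH !inE eqxx.
- apply: leq_trans (leq_mul (leqnn s) (subset_leq_card shadowG)).
  apply: (card_shadow (r := r) (V := ~: W) (k := k)) =>
    // [A|A i j iW jW rij|[f [fH fD]]].
  + by rewrite inE => /andP[/(subsetP FK)]; rewrite inE => -> ->.
  + rewrite !inE => /andP[AF AW] jA iA; rewrite (Fc A i j) //=.
    rewrite subUset sub1set iW /=; exact: subset_trans (subsetDl _ _) AW.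
  + by apply: Fm; exists f; split=> // a; have := fH a; rewrite inE => /andP[].
Qed.
End Stability.

(** * Binomial estimates *)

Lemma bin_mul_trinomial n k t : t <= k -> k <= n ->
  'C(n, t) * 'C(n - t, k - t) = 'C(n, k) * 'C(k, t).
Proof.
move=> tk kn; have f0 : 0 < t`! * (k - t)`! * (n - k)`! by rewrite !muln_gt0 !fact_gt0.
apply/eqP; rewrite -(eqn_pmul2r f0); apply/eqP.
have := bin_fact kn; have := bin_fact tk; have := bin_fact (leq_trans tk kn).
have := bin_fact (leq_sub2r t kn); rewrite subnBA // subnK ?(leq_trans tk kn) //.
move=> h1 h2 h3 h4.
have -> : 'C(n, t) * 'C(n - t, k - t) * (t`! * (k - t)`! * (n - k)`!) = n`!.
  by rewrite -h2 -h1 -!mulnA [RHS]mulnCA [RHS]mulnCA; congr (_ * _); rewrite mulnCA.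
rewrite -h4 -h3 -!mulnA; congr (_ * _); congr (_ * _).
Qed.

(** Union bound: each of the [a] removed points lies in a fraction [r / M] of the [r]-subsets of an
    [M]-set. *)
Lemma bin_subl_bound M a r :
  M * 'C(M, r) <= M * 'C(M - a, r) + a * r * 'C(M, r).
Proof.
elim: a => [|a IH]; first by rewrite subn0 leq_addr.
case: r IH => [|r] IH; first by rewrite !bin0 leq_addr.
case: (ltnP a M) => aM; last first.
  rewrite (_ : M - a.+1 = M - a); last by lia.
  by apply: leq_trans IH _; rewrite leq_add2l !leq_mul2r leqnSn !orbT.
have E : M - a = (M - a.+1).+1 by lia.
move: IH; rewrite {1}E binS mulnDr => IH.
have : M * 'C(M - a.+1, r) <= r.+1 * 'C(M, r.+1).
  by rewrite -mul_bin_diag leq_mul2l leq_bin2l ?orbT //; lia.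
rewrite [a.+1 * _]mulSn mulnDl; lia.
Qed.

Section Numerical.
Variables n s k t : nat.
Hypotheses (s_gt0 : 0 < s) (k_gt0 : 0 < k) (t_gt0 : 0 < t).
Hypothesis hn : 2 * k ^ 2 <= n.
Hypothesis hk : 5 * s * t <= k \/ (t = 1 /\ 3 * s <= k).

Lemma uniformity_ge3s : 3 * s <= k.
Proof. by clear hn k_gt0; case: hk => [|[]] //; nia. Qed.

Lemma uniformity_geDst : s + t <= k /\ s * t + 1 <= s + k.
Proof. by clear hn k_gt0; case: hk => [h|[-> h]]; nia. Qed.

Lemma ground_large : 2 * k * k.-1 + s.+1 <= n.
Proof. have := uniformity_ge3s; nia. Qed.

(** Here [M <= 2 (M - k (k - 1))], so [2 (2 k - s) s t < k (2 k - 2 s - 1)] suffices. This fails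
    only for [k = 3], [s = t = 1], where it reads [10 < 9]; that case follows from [M >= 17]. *)
Lemma constants_incompatible M : n = M + s ->
  k * (2 * k - 2 * s - 1) * (M - k * k.-1) <= (2 * k - s) * (s * t) * M -> False.
Proof.
move=> nE; have hM : 2 * (k * k) <= M + s by rewrite -nE; move: hn; rewrite -mulnn.
have k3 := uniformity_ge3s.
have M0 : 0 < M by nia.
have [k3s|[k3E s1]] : 2 * ((2 * k - s) * (s * t)) < k * (2 * k - 2 * s - 1) \/
    (k = 3 /\ s = 1).
- case: hk => [h|[-> _]].
    left; have h5 : 5 * (s * t) <= k by rewrite mulnA.
    have : 5 * s <= k by nia.
    move: (s * t) h5 => st h5 h6.
    have : 2 * (2 * k - s) < 5 * (2 * k - 2 * s - 1) by lia.
    move: (2 * k - s) (2 * k - 2 * s - 1) => a b ab; nia.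
  have [->|s2] : s = 1 \/ 1 < s by lia.
    case: (ltngtP k 3) => k3'; [lia| |by right].
    by left; have [d ->] : exists d, k = d + 4 by [exists (k - 4); lia]; nia.
  left; have [d ->] : exists d, k = d + 3 * s by exists (k - 3 * s); lia.
  have -> : 2 * (d + 3 * s) - s = 2 * d + 5 * s by lia.
  have -> : 2 * (d + 3 * s) - 2 * s - 1 = (2 * d + 4 * s - 1) by lia.
  nia.
- have hM2 : M <= 2 * (M - k * k.-1).
    have E : k * k = k * k.-1 + k by rewrite -mulnSr prednK.
    by clear - E hM k3; lia.
  move: k3s hM2; move: ((2 * k - s) * _) (k * _) (M - _) => a b c ab cM h.
  have : 2 * a * M < 2 * a * M by nia.
  by rewrite ltnn.
- have t1 : t = 1 by case: hk => [|[]] //; nia.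
  by rewrite k3E s1 t1 /=; move: hM; rewrite k3E s1; lia.
Qed.

(** Eliminating [f] and expressing the other binomials through [C] leaves [k b X <= a s t C],
    whereas [X] is at least [C] times [1 - k (k - 1) / (n - s)]. *)
Lemma bound_excludes_degree f :
  f * (2 * k - s) + 'C(n - s - k, k.-1) * (2 * k - 2 * s - 1)
    + (2 * k - s) * 'C(n - s, k) <= (2 * k - s) * 'C(n, k) ->
  'C(n, t) * ('C(n - t, k - t) - 'C(n - s - t, k - t)) <= f * 'C(k, t) ->
  False.
Proof.
have [stk stk'] := uniformity_geDst; have gl := ground_large.
have tk : t <= k by lia.
have kns : k <= n - s by nia.
have kn : k <= n by lia.
set a := 2 * k - s; set b := 2 * k - 2 * s - 1.
set X := 'C(n - s - k, k.-1); set P := 'C(n - s, k); set Q := 'C(n, k).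
set K := 'C(k, t); set Z := 'C(n, t); set Z' := 'C(n - s, t).
set c := 'C(n - s - t, k - t); set C := 'C(n - s, k.-1).
move=> hf; rewrite mulnBr (bin_mul_trinomial tk kn) -/Q -/K => hd.
have e2 : Z' * c = P * K by exact: bin_mul_trinomial.
have K0 : 0 < K by rewrite bin_gt0.
have Z'0 : 0 < Z' by rewrite bin_gt0; lia.
have C0 : 0 < C by rewrite bin_gt0; lia.
have a0 : 0 < a by rewrite /a; have := uniformity_ge3s; lia.
have s1 : X * b * K + a * P * K <= a * Z * c.
  have := leq_mul (leqnn K) hf; have : Q * K <= f * K + Z * c by lia.
  move=> /(leq_mul (leqnn a)); rewrite !mulnDr; lia.
have s2 : X * b * Z' + a * P * Z' <= a * P * Z.
  rewrite -(leq_pmul2r K0); have := leq_mul s1 (leqnn Z').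
  have -> : a * Z * c * Z' = a * P * Z * K.
    rewrite -[LHS]mulnA [c * _]mulnC e2 -!mulnA; congr (_ * _).
    by rewrite mulnCA [Z * K]mulnC.
  rewrite !mulnDl; lia.
have s3 : n * Z <= n * Z' + s * t * Z by exact: bin_subl_bound.
have nst : s * t < n by clear - stk' kns k_gt0; lia.
have nst0 : 0 < n - s * t by rewrite subn_gt0.
have s4 : (n - s * t) * (X * b) <= a * P * (s * t).
  rewrite -(leq_pmul2r Z'0).
  have h1 : (n - s * t) * Z <= n * Z' by rewrite mulnBl; lia.
  have h2 := leq_mul (leqnn (n - s * t)) s2.
  have h3 := leq_mul (leqnn (a * P)) h1.
  have E : n * Z' = (n - s * t) * Z' + s * t * Z' by rewrite -mulnDl subnK // ltnW.
  rewrite E in h3; move: h2 h3; rewrite !mulnDr.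
  move: (n - s * t) => d; lia.
have s5 : k * P = (n - s - k.-1) * C.
  by rewrite /P /C -[in LHS](prednK k_gt0) mul_bin_left.
have s6 : k * (X * b) <= a * (s * t) * C.
  rewrite -(leq_pmul2l nst0).
  have h1 := leq_mul (leqnn k) s4.
  (* This comparison uses [s t + 1 <= s + k]. *)
  have h2 : (n - s - k.-1) * C <= (n - s * t) * C.
    by rewrite leq_mul2r; apply/orP; right; lia.
  rewrite -s5 in h2; have h3 := leq_mul (leqnn (a * (s * t))) h2.
  move: h1 h3; move: (n - s * t) => d; lia.
have s7 : (n - s) * C <= (n - s) * X + k * k.-1 * C by exact: bin_subl_bound.
apply: (@constants_incompatible (n - s)); first by rewrite subnK //; lia.
rewrite -/a -/b -(leq_pmul2r C0).
have h1 : (n - s - k * k.-1) * C <= (n - s) * X by rewrite mulnBl leq_subLR addnC.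
have h2 := leq_mul (leqnn (k * b)) h1.
have h3 := leq_mul (leqnn (n - s)) s6.
move: h2 h3; move: (n - s - k * k.-1) => d; move: (n - s) => e; lia.
Qed.

End Numerical.

(** * Minimum degrees *)

Section Degrees.
Variable T : finType.
Implicit Types (F : {set {set T}}) (A B R S V : {set T}).

Lemma has_matching_number m k F : 0 < k -> F \subset ksets T k ->
  has_matching m F -> m <= matching_number F.
Proof.
move=> k0 /subsetP FK [f [fF fD]].
have fI : injective f.
  move=> a b E; apply/eqP/negPn/negP=> /fD.
  rewrite E -setI_eq0 setIid -cards_eq0.
  by have := FK _ (fF b); rewrite inE => /eqP ->; rewrite eqn0Ngt k0.
rewrite -[leqLHS](card_ord m) -cardsT -(card_imset _ fI).
apply: (@leq_bigmax_cond _ _ (fun M : {set {set T}} => #|M|)).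
apply/andP; split; first by apply/subsetP=> _ /imsetP[a _ ->].
apply/trivIsetP=> _ _ /imsetP[a _ ->] /imsetP[b _ ->] nf; apply: fD.
by apply: contraNneq nf => ->.
Qed.

Lemma min_degree_le t F S : #|S| = t -> min_degree t F <= degree F S.
Proof.
move=> St; have : S \in index_enum {set T} by rewrite mem_index_enum.
rewrite /min_degree; elim: (index_enum _) => // S' l IH.
rewrite inE big_cons => /orP[/eqP<-|/IH]; first by rewrite inE St eqxx geq_minl.
case: ifP => // _; apply: leq_trans; exact: geq_minr.
Qed.

Lemma le_min_degree t F c : c <= #|F| ->
  (forall S, #|S| = t -> c <= degree F S) -> c <= min_degree t F.
Proof.
move=> cF cS; rewrite /min_degree; elim/big_ind: _ => // [x y cx cy|S].
  by rewrite leq_min cx cy.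
by rewrite inE => /eqP/cS.
Qed.

(** Double counting of the pairs [S \subset A] with [#|S| = t] and [A] in [F]. *)
Lemma min_degree_averaging k t F : F \subset ksets T k ->
  'C(#|T|, t) * min_degree t F <= #|F| * 'C(k, t).
Proof.
move=> /subsetP FK; rewrite -[X in 'C(X, t)]cardsT -cards_draws -sum_nat_const.
apply: leq_trans (_ : \sum_(S in draws [set: T] t) degree F S <= _).
  by apply: leq_sum => S; rewrite inE => /andP[_ /eqP/min_degree_le].
have E S : degree F S = \sum_(A in F) (S \subset A).
  rewrite /degree -sum1_card (eq_bigl (fun A => (A \in F) && (S \subset A))).
    by rewrite big_mkcondr; apply: eq_bigr => A _; case: (S \subset A).
  by move=> A; rewrite inE.
rewrite (eq_bigr _ (fun S _ => E S)) exchange_big -sum_nat_const.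
apply: leq_sum => A /FK; rewrite inE => /eqP <-.
rewrite -cards_draws -sum1_card big_mkcond [leqRHS]big_mkcond /=.
by apply: leq_sum => S _; rewrite !inE subsetT; case: eqP; case: (S \subset A).
Qed.

Lemma card_draws_above V S k : S \subset V -> #|S| <= k ->
  #|[set A in draws V k | S \subset A]| = 'C(#|V| - #|S|, k - #|S|).
Proof.
move=> SV Sk; have -> : #|V| - #|S| = #|V :\: S| by rewrite cardsD (setIidPr SV).
rewrite -cards_draws -/(draws (V :\: S) (k - #|S|)).
rewrite -(@card_in_imset _ _ (setU S) (draws (V :\: S) (k - #|S|))); last first.
  move=> B B'; rewrite !inE !subsetD => /andP[/andP[_ dB] _] /andP[/andP[_ dB'] _].
  move=> /(congr1 (fun X => X :\: S)); rewrite !setDUl setDv !set0U.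
  by rewrite !(setDidPl _).
apply: eq_card => A; rewrite !inE; apply/idP/imsetP.
  case/andP=> /andP[AV /eqP Ak] SA; exists (A :\: S); last first.
    by rewrite -[X in X :|: _](setIidPr SA) setID.
  by rewrite inE setSD //= cardsD (setIidPr SA) Ak.
case=> B; rewrite inE subsetD => /andP[/andP[BV dB] /eqP cB] ->.
rewrite subUset SV BV subsetUl andbT /= cardsU cB.
by rewrite setIC (disjoint_setI0 dB) cards0 subn0 subnKC.
Qed.

Lemma exists_draw V t : t <= #|V| -> exists2 S : {set T}, S \subset V & #|S| = t.
Proof.
rewrite -bin_gt0 -cards_draws => /card_gt0P[S].
by rewrite inE => /andP[? /eqP]; exists S.
Qed.

(** [A0] with an arbitrary set [S] in place of the initial segment, since the cover found in a
    family can be any [s]-set. *)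
Definition meeting_sets k S := [set A in ksets T k | A :&: S != set0].

Lemma degree_meeting_sets k S R : #|R| <= k ->
  degree (meeting_sets k S) R + #|[set A in draws (~: S) k | R \subset A]|
    = 'C(#|T| - #|R|, k - #|R|).
Proof.
move=> Rk; rewrite -[X in 'C(X - _, _)]cardsT -card_draws_above ?subsetT //.
rewrite -(cardsID [set A | A :&: S != set0] [set A in draws [set: T] k | R \subset A]).
congr (_ + _); apply: eq_card => A; rewrite !inE subsetT /=.
  by rewrite andbAC.
by rewrite negbK setI_eq0 disjoints_subset; case: (A \subset _); rewrite ?andbF ?andbT.
Qed.

Lemma degree_meeting_sets_disjoint k S R : #|R| <= k -> R \subset ~: S ->
  degree (meeting_sets k S) R =
  'C(#|T| - #|R|, k - #|R|) - 'C(#|T| - #|S| - #|R|, k - #|R|).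
Proof.
move=> Rk RS; rewrite -(degree_meeting_sets S Rk) card_draws_above //.
by rewrite cardsCs setCK addnK.
Qed.

Lemma min_degree_meeting_sets k t S : t <= k -> t + #|S| <= #|T| ->
  min_degree t (meeting_sets k S) =
  'C(#|T| - t, k - t) - 'C(#|T| - #|S| - t, k - t).
Proof.
move=> tk tS; have [R RS Rt] : exists2 R : {set T}, R \subset ~: S & #|R| = t.
  by apply: exists_draw; rewrite cardsCs setCK; lia.
have dR : degree (meeting_sets k S) R =
    'C(#|T| - t, k - t) - 'C(#|T| - #|S| - t, k - t).
  by rewrite degree_meeting_sets_disjoint // Rt.
apply/eqP; rewrite eqn_leq -{1}dR min_degree_le //=.
apply: le_min_degree => [|R' R't].
  rewrite -dR; apply: subset_leq_card; apply/subsetP=> A.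
  by case/setIdP.
rewrite -R't -(degree_meeting_sets S) ?R't // leq_subLR addnC leq_add2r.
(* A [t]-set that meets [S] has all its [k]-supersets in the family, so the minimum is attained off
   [S]. *)
have [R'S|R'S] := boolP (R' \subset ~: S).
  by rewrite card_draws_above ?R't // cardsCs setCK.
rewrite (_ : [set _ in _ | _] = set0) ?cards0 //.
apply/setP=> A; rewrite !inE; apply/negP=> /andP[/andP[AS _] R'A].
by rewrite (subset_trans R'A AS) in R'S.
Qed.

Lemma min_degree_meeting_sets_rigid k t S F : t <= k -> t + #|S| <= k -> k <= #|T| ->
  F \subset meeting_sets k S ->
  min_degree t F <= min_degree t (meeting_sets k S) /\
  (min_degree t F = min_degree t (meeting_sets k S) -> F = meeting_sets k S).
Proof.
move=> tk tSk kT FS; have tS := leq_trans tSk kT.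
have dS R : #|R| = t -> R \subset ~: S ->
    degree (meeting_sets k S) R = min_degree t (meeting_sets k S).
  by move=> Rt RS; rewrite min_degree_meeting_sets // degree_meeting_sets_disjoint ?Rt.
have sub R : [set A in F | R \subset A] \subset
             [set A in meeting_sets k S | R \subset A].
  apply/subsetP=> A /setIdP[/(subsetP FS) AS RA].
  by rewrite inE AS.
split.
  have [R RS Rt] : exists2 R : {set T}, R \subset ~: S & #|R| = t.
    by apply: exists_draw; rewrite cardsCs setCK; lia.
  rewrite -(dS R) //; apply: leq_trans (min_degree_le F Rt) _.
  exact: subset_leq_card.
move=> E; apply/eqP; rewrite eqEsubset FS /=; apply/subsetP=> A AS.
apply: contraT => AF; have := AS; rewrite !inE => /andP[/eqP Ak _].
(* As [t + #|S| <= k], a missing member [A] has a [t]-subset [R] off [S]. Its degree in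
   [meeting_sets k S] is the minimum, and [F] loses at least [A] from it. *)
have [R RA Rt] : exists2 R : {set T}, R \subset A :\: S & #|R| = t.
  apply: exists_draw; rewrite cardsD Ak.
  have := subset_leq_card (subsetIr A S); lia.
move: RA; rewrite subsetD => /andP[RA RS].
have : min_degree t F < min_degree t (meeting_sets k S).
  rewrite -(dS R) -?disjoints_subset //; apply: leq_ltn_trans (min_degree_le F Rt) _.
  apply: proper_card; apply/properP; split; first exact: sub.
  by exists A; rewrite inE ?AS ?RA // (negbTE AF).
by rewrite E ltnn.
Qed.

End Degrees.

Theorem theorem7 (n s k t : nat)
    (n_gt0 : 0 < n) (s_gt0 : 0 < s) (k_gt0 : 0 < k) (t_gt0 : 0 < t)
    (hn : 2 * k ^ 2 <= n)
    (hk : 5 * s * t <= k \/ (t = 1 /\ 3 * s <= k)) :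
  min_degree t (A0 n k s) = 'C(n - t, k - t) - 'C(n - s - t, k - t) /\
  forall F : {set {set 'I_n}},
    F \subset ksets 'I_n k ->
    matching_number F <= s ->
    min_degree t F <= min_degree t (A0 n k s) /\
    (min_degree t F = min_degree t (A0 n k s) ->
     isomorphic_families (A0 n k s) F).
Proof.
have k3 := uniformity_ge3s s_gt0 t_gt0 hk.
have [stk _] := uniformity_geDst s_gt0 t_gt0 hk.
have gl := ground_large s_gt0 k_gt0 t_gt0 hn hk.
have kn : k <= n by move: hn; rewrite -mulnn; nia.
have cI : #|initial n s| = s.
  have sn : s <= n by lia.
  rewrite -[RHS](card_ord s) -[in RHS]cardsT.
  have wI : injective (widen_ord sn).
    by move=> i j /(congr1 val) E; apply: ord_inj.
  rewrite -(card_imset _ wI); apply: eq_card => i.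
  rewrite inE; apply/idP/imsetP => [si|[j _ ->]]; last exact: (ltn_ord j).
  by exists (Ordinal si) => //; apply: ord_inj.
have d0 (S : {set 'I_n}) : #|S| = s -> min_degree t (meeting_sets k S) =
    'C(n - t, k - t) - 'C(n - s - t, k - t).
  move=> cS; have := @min_degree_meeting_sets _ k t S; rewrite card_ord cS.
  by apply; lia.
split; first exact: d0.
move=> F FK Fs; have A0E : min_degree t (A0 n k s) = _ := d0 _ cI.
have Fm : ~ has_matching s.+1 F.
  by move=> /(has_matching_number k_gt0 FK); rewrite ltnNge Fs.
(* A cover of size [s] puts [F] inside a relabelled [A0], where rigidity applies. Without one the
   inequality is strict. *)
have [/existsP[S /andP[/eqP cS FS]]|nS] := boolP
    [exists S : {set 'I_n}, (#|S| == s) && covers S F].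
  have FS' : F \subset meeting_sets k S.
    apply/subsetP=> A AF; rewrite inE (subsetP FK) //=.
    exact: (forall_inP FS).
  have [|||le eq] := min_degree_meeting_sets_rigid (t := t) _ _ _ FS';
    rewrite ?card_ord ?cS; try lia.
  rewrite A0E -(d0 S cS); split=> // /eq ->.
  (* The relabelling is any permutation carrying the initial segment onto [S]. *)
  have [|p _ pS] := perm_moving (subsetT (initial n s)) (subsetT S); first by rewrite cI.
  exists p; apply/setP=> A; rewrite !inE; apply/andP/imsetP => [[Ak AS]|[B]].
    exists (p @^-1: A).
      rewrite !inE; apply/andP; split.
        by rewrite card_preimset //; exact: perm_inj.
      apply: contraNneq AS => E; rewrite -pS; apply/eqP/setP=> x; rewrite !inE.
      apply/negP=> /andP[xA /imsetP[y yI xE]].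
      by have := in_set0 y; rewrite -E !inE -xE xA; move: yI; rewrite inE => ->.
    apply/setP=> x; apply/idP/imsetP => [xA|[y]]; last by rewrite inE => + ->.
    by exists (p^-1 x)%g; rewrite ?inE permKV.
  rewrite !inE => /andP[Bk BI] ->; split.
    by rewrite card_imset //; exact: perm_inj.
  rewrite -pS -imsetI; last by move=> ? ? _ _; exact: perm_inj.
  by rewrite imset_eq0.
suff lt : min_degree t F < min_degree t (A0 n k s).
  by split; [exact: ltnW | move=> E; rewrite E ltnn in lt].
rewrite ltnNge; apply/negP=> le.
have bound : stability_bound s k F.
  apply: uncovered_family_bound => //; first by rewrite card_ord.
  by move=> S cS; apply: contraNN nS => FS; apply/existsP; exists S; rewrite cS eqxx.
rewrite /stability_bound card_ord in bound.
apply: (bound_excludes_degree s_gt0 k_gt0 t_gt0 hn hk bound).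
rewrite -A0E; apply: leq_trans (leq_mul (leqnn _) le) _.
by have := min_degree_averaging t FK; rewrite card_ord.
Qed.
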